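(* Let $X$ be a reflexive Banach space with $1$-symmetric basis. Then $X$ is isomorphic to a complemented subspace of $JF_X$.
   Context: $X$ is a (infinite-dimensional, real) reflexive Banach space with a $1$-symmetric basis $(e_n)_n$, i.e. $\|\sum_n \epsilon_n a_n e_{\pi(n)}\|_X=\|\sum_n a_n e_n\|_X$ for all finitely supported real $(a_n)$, signs $\epsilon_n$ and permutations $\pi$ of $\mathbb{N}$. $JF_X$ is the completion of $L^1((0,1))$ under the norm $\|f\|_{JF_X}=\sup\{\|\sum_{j=1}^m(\int_{I_j}f\,d\mu)e_j\|_X : I_1,\dots,I_m\subset(0,1)\text{ pairwise disjoint open intervals}\}$, where $\mu$ is Lebesgue measure. *)

(* Defs.v *)
From HB Require Import structures.
From mathcomp Require Import all_boot all_order all_algebra.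
From mathcomp Require Import all_classical all_reals all_analysis.

Set Implicit Arguments.
Unset Strict Implicit.
Unset Printing Implicit Defensive.

Import Order.TTheory GRing.Theory Num.Theory.
Import numFieldNormedType.Exports.

Local Open Scope classical_set_scope.
Local Open Scope ring_scope.

Section Reflexivity.
Context {R : realType} (X : normedModType R).

Definition dual : set (X -> R) := [set f : X -> R | scalar f /\ continuous f].

Definition dual_norm (f : X -> R) : R :=
  sup [set `|f x| | x in [set x : X | `|x| <= 1]].

(* Elements of the bidual are represented by functions on all of [X -> R];
   only their values on [dual] matter. *)
Definition bidual : set ((X -> R) -> R) :=
  [set phi |
    (forall (k : R) (f g : X -> R), dual f -> dual g ->
       phi (fun x => k * f x + g x) = k * phi f + phi g) /\
    (exists C : R, forall f, dual f -> `|phi f| <= C * dual_norm f)].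

Definition reflexive_space : Prop :=
  forall phi, bidual phi -> exists x : X, forall f, dual f -> phi f = f x.

End Reflexivity.

Section Bases.
Context {R : realType} {X : normedModType R}.

Definition schauder_basis (e : nat -> X) : Prop :=
  forall x : X, exists! a : nat -> R,
    series (fun n => a n *: e n) @ \oo --> x.

(* A finitely supported scalar sequence is given by its values below [N]. *)
Definition one_symmetric (e : nat -> X) : Prop :=
  forall (N : nat) (a : nat -> R) (s : nat -> bool) (p : nat -> nat),
    bijective p ->
    `|\sum_(n < N) ((-1) ^+ s n * a n) *: e (p n)| = `|\sum_(n < N) a n *: e n|.

Definition one_symmetric_basis (e : nat -> X) : Prop :=
  schauder_basis e /\ one_symmetric e.

End Bases.

Section JamesFunctionSpace.
Context {R : realType}.
Local Notation mu := (@lebesgue_measure R).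

(* The class in L^1((0,1)) of a function depends only on its restriction to
   (0,1), up to null sets. *)
Definition L1_01 : set (R -> R) :=
  [set f | mu.-integrable `]0, 1[ (EFin \o f)].

(* [a j] and [b j] are the end points of the interval I_j.
   For [f] in [L1_01] and a 1-symmetric [e] this set is bounded above by
   the L^1 norm of [f] times the norm of [e 0], so that [sup] is the supremum. *)
Definition JF_norm {X : normedModType R} (e : nat -> X) (f : R -> R) : R :=
  sup [set r | exists m (a b : 'I_m -> R),
    [/\ forall j, [/\ 0 <= a j, a j < b j & b j <= 1],
        trivIset [set: 'I_m] (fun j => `]a j, b j[%classic) &
        r = `|\sum_(j < m) (\int[mu]_(x in `]a j, b j[) f x) *: e j|]].

(* [J] with [iota] is a completion of L^1((0,1)) under [JF_norm e]; this
   determines [J] up to isometric isomorphism.  Functions equal almost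
   everywhere on (0,1) have the same image, since their difference has
   [JF_norm] zero.  The values of [iota] outside [L1_01] are irrelevant. *)
Definition is_JF {X : normedModType R} (e : nat -> X)
    (J : completeNormedModType R) (iota : (R -> R) -> J) : Prop :=
  [/\ forall (k : R) (f g : R -> R), L1_01 f -> L1_01 g ->
        iota (fun x => k * f x + g x) = k *: iota f + iota g,
      forall f, L1_01 f -> `|iota f| = JF_norm e f &
      dense (iota @` L1_01)].

End JamesFunctionSpace.

Section Subspaces.
Context {R : realType}.

Definition complemented {J : normedModType R} (Y : set J) : Prop :=
  exists P : {linear J -> J},
    [/\ continuous P, forall x, P (P x) = P x & range P = Y].

(* [Y] is the range of a linear map [T], hence a linear subspace, and [T] is a
   homeomorphism onto [Y] with inverse [S]. *)
Definition isomorphic_to_subspace (X J : normedModType R) (Y : set J) : Prop :=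
  exists (T : {linear X -> J}) (S : J -> X),
    [/\ continuous T, range T = Y, cancel T S & {within Y, continuous S}].

End Subspaces.

(* Main.v *)
(* Let [f_n = haar n] be the Haar-type function of mean zero carried by
   [J_n = (2^-(n+1), 2^-n)], with integral [1] over the left half [A_n] of [J_n].
   The map [q f = \sum_n (\int_(A_n) f) e_n] is contractive from the [JF] norm to
   [X], since the [A_n] are admissible intervals. Conversely the map
   [T (\sum_n a_n e_n) = \sum_n a_n f_n] is bounded: an interval sees only those
   [f_n] whose support contains one of its end points, so that the vector of
   interval integrals of [\sum_n a_n f_n] is the image of [a] under two matrices
   with one entry per row and column sums at most [2], and such matrices are
   bounded for a 1-symmetric norm. As [q T = id], the map [T q] is a projection
   of [JF] onto [T X], and [T] is an isomorphism onto its range. *)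
Require Import Defs.
From HB Require Import structures.
From mathcomp Require Import all_boot all_order all_algebra.
From mathcomp Require Import all_classical all_reals all_analysis.
From mathcomp Require Import zify lra.
Import Order.TTheory GRing.Theory Num.Theory.
Import numFieldNormedType.Exports.
Local Open Scope classical_set_scope.
Local Open Scope ring_scope.

(** * Inequalities for norms invariant under signs and permutations *)

Section SymmetricSequences.
Context {R : realType} {X : normedModType R} {e : nat -> X}.
Context (e_sym : one_symmetric e).

Lemma symmetric_perm (N : nat) (a : nat -> R) (p : nat -> nat) : bijective p ->
  `|\sum_(n < N) a n *: e (p n)| = `|\sum_(n < N) a n *: e n|.
Proof.
move=> bp; rewrite -(e_sym _ _ (fun=> false) _ bp); congr (`|_|).
by apply: eq_bigr => n _; rewrite expr0 mul1r.
Qed.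

(** Apply the transposition of [0] and [n] to a sum with one term. Finite combinations are thus
    bounded by the l^1 norm of their coefficients times the norm of [e 0]. *)
Lemma symmetric_norm_basis (n : nat) : `|e n| = `|e 0|.
Proof.
pose p k := if k == 0%N then n else if k == n then 0%N else k.
have pK : involutive p.
  move=> k; rewrite /p; have [->|k0] := eqVneq k 0%N.
    by have [->|_] := eqVneq n 0%N; rewrite ?eqxx.
  by have [->|kn] := eqVneq k n; rewrite ?eqxx// (negbTE k0) (negbTE kn).
have := symmetric_perm 1 (fun=> 1) _ (inv_bij pK).
by rewrite !big_ord1 !scale1r.
Qed.

(* Both sides are coordinate expansions that differ by a transposition and a
   sign change. *)
Lemma symmetric_exchange (M i q : nat) (b : nat -> R) (t c : R) :
  (i < M)%N -> (q < M)%N -> b i = 0 -> b q = 0 -> `|t| = `|c| ->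
  `|\sum_(n < M) b n *: e n + t *: e i| = `|\sum_(n < M) b n *: e n + c *: e q|.
Proof.
move=> iM qM bi bq tc.
pose p k := if k == q then i else if k == i then q else k.
have pK : involutive p.
  move=> k; rewrite /p; have [->|kq] := eqVneq k q.
    by have [->|_] := eqVneq i q; rewrite ?eqxx.
  have [->|ki] := eqVneq k i; first by rewrite eqxx.
  by rewrite (negbTE kq) (negbTE ki).
have addE (d : R) (w : nat -> nat) : \sum_(n < M) b n *: e (w n) + d *: e (w q) =
    \sum_(n < M) (b n + (n == q :> nat)%:R * d) *: e (w n).
  under [RHS]eq_bigr do rewrite scalerDl.
  rewrite big_split/=; congr (_ + _).
  rewrite (bigD1 (Ordinal qM))//= eqxx mul1r big1 ?addr0// => k kq.
  have /negbTE -> : (k : nat) != q by [].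
  by rewrite mul0r scale0r.
(* The transposition [p] moves only [i] and [q], where [b] vanishes, so it leaves the first sum
   unchanged. *)
have -> : \sum_(n < M) b n *: e n + t *: e i =
    \sum_(n < M) b n *: e (p n) + t *: e (p q).
  congr (_ + _); last by rewrite /p eqxx.
  apply: eq_bigr => k _; rewrite /p.
  have [->|kq] := eqVneq (k : nat) q; first by rewrite bq !scale0r.
  by have [->|//] := eqVneq (k : nat) i; rewrite bi !scale0r.
(* The sign is changed only at [q], and only when [t] differs from [c]; equality of absolute values
   then forces [t = - c]. *)
rewrite addE (addE c (fun k => k)) /= 
  -(e_sym _ (fun n => b n + (n == q)%:R * c) (fun n => (n == q) && (t != c)) _
      (inv_bij pK)).
congr (`|_|); apply: eq_bigr => k _; congr (_ *: _).
have [->|kq] := eqVneq (k : nat) q; last by rewrite expr0 !mul0r addr0 mul1r.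
rewrite bq !add0r/= !mul1r; have [->|ntc] := eqVneq t c; first by rewrite expr0 mul1r.
rewrite expr1 mulN1r; move/eqP: tc; rewrite eqr_norm2 (negbTE ntc)/=.
by move/eqP.
Qed.

(** The sum without [e q] is the midpoint of the two vectors with coefficient [c] and [- c] at [q],
    and these have equal norm. *)
Lemma symmetric_delete (M q : nat) (b : nat -> R) (c : R) :
  (q < M)%N -> b q = 0 ->
  `|\sum_(n < M) b n *: e n| <= `|\sum_(n < M) b n *: e n + c *: e q|.
Proof.
move=> qM bq; set u := \sum_(n < M) _.
have uN : `|u + - c *: e q| = `|u + c *: e q|.
  by apply: symmetric_exchange => //; rewrite normrN.
have : `|2 *: u| <= `|u + c *: e q| + `|u + - c *: e q|.
  apply: le_trans (ler_normD _ _).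
  by rewrite addrACA scaleNr subrr addr0 scaler_nat mulr2n.
by rewrite uN normrZ ger0_norm//; lra.
Qed.

(* [u + c v] is a convex combination of [u] and of the vectors [u +- c e_i],
   and none of these is longer than [u + c e_q]. *)
Lemma symmetric_concentrate (M q : nat) (b v : nat -> R) (c : R) :
  (q < M)%N -> b q = 0 -> (forall i, (i < M)%N -> b i * v i = 0) ->
  \sum_(i < M) `|v i| <= 1 ->
  `|\sum_(n < M) b n *: e n + c *: \sum_(n < M) v n *: e n|
    <= `|\sum_(n < M) b n *: e n + c *: e q|.
Proof.
move=> qM bq bv v1; set u := \sum_(n < M) b n *: _; set K := `|u + c *: e q|.
have -> : u + c *: \sum_(n < M) v n *: e n =
    \sum_(n < M) `|v n| *: (u + (c * Num.sg (v n)) *: e n)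
    + (1 - \sum_(n < M) `|v n|) *: u.
  under [X in _ = X + _]eq_bigr do
    rewrite scalerDr scalerA mulrCA [X in _ * X]mulrC -numEsg.
  rewrite big_split/= -scaler_suml scalerBl scale1r addrAC addrCA subrr addr0.
  by congr (_ + _); rewrite scaler_sumr; apply: eq_bigr => n _; rewrite scalerA.
apply: le_trans (ler_normD _ _) _.
have uK : `|u| <= K by exact: symmetric_delete.
have -> : K = (\sum_(n < M) `|v n|) * K + (1 - \sum_(n < M) `|v n|) * K.
  by rewrite -mulrDl addrC subrK mul1r.
apply: lerD.
  apply: le_trans (ler_norm_sum _ _ _) _; rewrite mulr_suml.
  apply: ler_sum => n _; rewrite normrZ normr_id.
  (* Where [v n] is nonzero, [b n] must vanish, which is what the exchange of [n] and [q]
     requires. *)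
  have [->|vn] := eqVneq (v n) 0; first by rewrite normr0 !mul0r.
  rewrite ler_pM2l ?normr_gt0// /K /u le_eqVlt; apply/orP; left; apply/eqP.
  apply: symmetric_exchange => //.
    by have /eqP := bv n (ltn_ord n); rewrite mulf_eq0 (negbTE vn) orbF => /eqP.
  by rewrite normrM normr_sg vn mulr1.
by rewrite normrZ ger0_norm ?subr_ge0// ler_wpM2l ?subr_ge0.
Qed.

(** A shift need not be a bijection of the naturals, but on the first [N] indices it agrees with the
    exchange of the blocks [[0, N)] and [[N, N + m)]. *)
Lemma symmetric_shift (m N : nat) (a : nat -> R) :
  `|\sum_(n < N) a n *: e (m + n)%N| = `|\sum_(n < N) a n *: e n|.
Proof.
pose swap (k l i : nat) :=
  if (i < k)%N then (l + i)%N else if (i < k + l)%N then (i - k)%N else i.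
have swapK k l : cancel (swap k l) (swap l k).
  move=> i; rewrite /swap; case: (ltnP i k) => ik.
    by rewrite ltnNge leq_addr/= ltn_add2l ik addKn.
  by case: (ltnP i (k + l)) => ikl; do ?case: ifPn; lia.
rewrite -(symmetric_perm _ a _ (Bijective (swapK N m) (swapK m N))).
by congr (`|_|); apply: eq_bigr => n _; rewrite /swap ltn_ord.
Qed.

(* The columns are spread out one after the other, starting from
   [\sum_n a_n e_(m + n)]. *)
Lemma symmetric_disjoint_columns (m N : nat) (D : nat -> nat -> R) (a : nat -> R) :
  (forall j n k, n != k -> D j n * D j k = 0) ->
  (forall n, \sum_(j < m) `|D j n| <= 1) ->
  `|\sum_(j < m) (\sum_(n < N) D j n * a n) *: e j| <= `|\sum_(n < N) a n *: e n|.
Proof.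
move=> Ddisj Dcol; rewrite -(symmetric_shift m).
(* In [b k l] the first [m] positions hold the contribution of the columns below [k], and position
   [m + n] holds [a n] for those [n >= l] not yet spread out. Thus [w 0 0] is the shifted vector and
   [w N N] the image. *)
pose b (k l i : nat) :=
  if (i < m)%N then \sum_(n < k) D i n * a n
  else if (l <= i - m)%N then a (i - m)%N else 0.
pose w k l := \sum_(i < m + N) b k l i *: e i.
have -> : \sum_(j < m) (\sum_(n < N) D j n * a n) *: e j = w N N.
  rewrite /w big_split_ord/= [X in _ + X]big1 ?addr0.
    by apply: eq_bigr => j _; rewrite /b ltn_ord.
  move=> n _; rewrite /b ltnNge leq_addr/= addKn leqNgt ltn_ord/=.
  by rewrite scale0r.
have -> : \sum_(n < N) a n *: e (m + n)%N = w 0%N 0%N.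
  rewrite /w big_split_ord/= [X in _ = X + _]big1 ?add0r.
    by apply: eq_bigr => n _; rewrite /b ltnNge leq_addr/= addKn.
  by move=> j _; rewrite /b ltn_ord big_ord0 scale0r.
suff step k : (k < N)%N -> `|w k.+1 k.+1| <= `|w k k|.
  have H k : (k <= N)%N -> `|w k k| <= `|w 0%N 0%N|.
    elim: k => // k IH kN; apply: le_trans (step _ kN) (IH (ltnW kN)).
  exact: H.
(* Both [w k k] and [w k.+1 k.+1] are compared with [w k k.+1], from which the term of [a k] is
   absent: the former adds it at [m + k], the latter along the column [v]. *)
move=> kN; pose v i := if (i < m)%N then D i k else 0.
have -> : w k k = w k k.+1 + a k *: e (m + k)%N.
  have kmN : (m + k < m + N)%N by rewrite ltn_add2l.
  rewrite /w (bigD1 (Ordinal kmN))//= [in RHS](bigD1 (Ordinal kmN))//=.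
  rewrite addrC [in RHS]addrAC -scalerDl [RHS]addrC; congr (_ + _ *: _).
    apply: eq_bigr => i ik; congr (_ *: _); rewrite /b.
    case: ifPn => // im; have {}ik : (i : nat) != (m + k)%N by [].
    by rewrite (_ : (k < i - m)%N = (k <= i - m)%N)//; lia.
  by rewrite /b ltnNge leq_addr/= addKn leqnn ltnn add0r.
have -> : w k.+1 k.+1 = w k k.+1 + a k *: \sum_(i < m + N) v i *: e i.
  rewrite /w scaler_sumr -big_split/=; apply: eq_bigr => i _.
  rewrite scalerA -scalerDl; congr (_ *: _); rewrite /b /v.
  by case: ifPn => im; rewrite ?mulr0 ?addr0// big_ord_recr/= [a k * _]mulrC.
apply: symmetric_concentrate.
- by rewrite ltn_add2l.
- by rewrite /b ltnNge leq_addr/= addKn ltnn.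
(* A row with a nonzero entry in column [k] has received nothing from earlier columns. *)
- move=> i _; rewrite /b /v; case: ifPn => im; last by rewrite mulr0.
  rewrite mulr_suml big1// => n _.
  by rewrite mulrAC Ddisj ?mul0r// neq_ltn ltn_ord.
- rewrite big_split_ord/= [X in _ + X]big1 ?addr0.
    by under eq_bigr do rewrite /v ltn_ord.
  by move=> i _; rewrite /v ltnNge leq_addr/= normr0.
Qed.

End SymmetricSequences.

(** * Dyadic Haar-type functions and their integrals *)

Section DyadicHaar.
Context {R : realType}.
Local Notation mu := (@lebesgue_measure R).
Local Notation measurable := (@measurable _ (measurableTypeR R)).

(** Triangle inequality on each set, then additivity over the disjoint union. It serves for the
    finiteness of the [JF] norm, the column sums of the interval integrals and the absolute
    convergence of the coefficient series. *)
Lemma sum_normr_Rintegral (f : R -> R) (m : nat) (F : 'I_m -> set R) :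
  L1_01 f -> (forall j, measurable (F j)) -> (forall j, F j `<=` `]0, 1[) ->
  trivIset [set: 'I_m] F ->
  \sum_(j < m) `|\int[mu]_(x in F j) f x| <= \int[mu]_(x in `]0, 1[) `|f x|.
Proof.
move=> fL mF F01 tF.
have fF j : mu.-integrable (F j) (EFin \o f) by apply: (integrableS _ (mF j) (F01 j) fL).
apply: (@le_trans _ _ (\sum_(j < m) \int[mu]_(x in F j) `|f x|)).
  by apply: ler_sum => j _; exact: le_normr_Rintegral.
have nfL D : mu.-integrable D (EFin \o f) ->
    mu.-integrable D (EFin \o (fun x => `|f x|)).
  by move=> /integrable_norm.
have nfin D : measurable D -> mu.-integrable D (EFin \o f) ->
    (\int[mu]_(x in D) `|f x|)%:E = (\int[mu]_(x in D) `|f x|%:E)%E.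
  by move=> mD fD; rewrite /Rintegral fineK//; apply: integrable_fin_num (nfL _ fD).
rewrite -lee_fin -sumEFin nfin//.
under eq_bigr do rewrite nfin//.
have mU : measurable (\big[setU/set0]_(j < m) F j).
  by apply: bigsetU_measurable => j _.
have U01 : \big[setU/set0]_(j < m) F j `<=` `]0, 1[.
  by rewrite -bigcup_seq => x [j _ /F01].
have /integrableP[mnf _] := nfL _ fL.
rewrite -ge0_integral_bigsetU//.
- by apply: ge0_subset_integral => //= x _; rewrite lee_fin.
- by rewrite index_enum_uniq.
- exact: sub_trivIset tF.
- exact: measurable_funS mnf.
Qed.

(* The [n]-th function is carried by [(2 h, 4 h) = (2^-(n+1), 2^-n)], where
   [h = 2^-(n+2)]. *)
Definition haar_step (n : nat) : R := (2 ^+ n.+2)^-1.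

Definition haar_left (n : nat) : set R := `]2 * haar_step n, 3 * haar_step n[.

Definition haar_right (n : nat) : set R := `]3 * haar_step n, 4 * haar_step n[.

Definition haar_supp (n : nat) : set R := `]2 * haar_step n, 4 * haar_step n[.

Definition haar (n : nat) (x : R) : R :=
  (haar_step n)^-1 * (\1_(haar_left n) x - \1_(haar_right n) x).

Lemma haar_step_gt0 n : 0 < haar_step n.
Proof. by rewrite invr_gt0 exprn_gt0. Qed.

Lemma haar_stepS n : haar_step n.+1 = haar_step n / 2.
Proof. by rewrite /haar_step exprSr invfM. Qed.

(** Doubled, this says that the right end [4 * haar_step k] of one support is at most the left end
    [2 * haar_step n] of the other. *)
Lemma haar_step_lt n k : (n < k)%N -> 2 * haar_step k <= haar_step n.
Proof.
elim: k => // k IH; rewrite ltnS leq_eqVlt haar_stepS => /predU1P[->|/IH].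
  by lra.
by have := haar_step_gt0 k; lra.
Qed.

Lemma haar_step_le n : 4 * haar_step n <= 1.
Proof.
have h0 : 4 * haar_step 0 = 1.
  by rewrite /haar_step expr2 -natrM mulfV// pnatr_eq0.
have [->|n0] := eqVneq n 0%N; first by rewrite h0.
have := haar_step_lt 0%N n; rewrite lt0n => /(_ n0).
by have := haar_step_gt0 n; lra.
Qed.

Lemma haar_supp_inj n k x : haar_supp n x -> haar_supp k x -> n = k.
Proof.
wlog: n k / (n <= k)%N => [H|]; first case: (leqP n k) => [|/ltnW] nk hn hk.
- exact: H.
- exact/esym/H.
rewrite leq_eqVlt => /predU1P[//|/haar_step_lt nk].
by rewrite /haar_supp/= !in_itv/= => /andP[? ?] /andP[? ?]; exfalso; lra.
Qed.

Lemma haar_left_supp n : haar_left n `<=` haar_supp n.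
Proof.
move=> x; rewrite /haar_left /haar_supp/= !in_itv/= => /andP[? ?].
by have h0 := haar_step_gt0 n; apply/andP; split; lra.
Qed.

Lemma haar_right_supp n : haar_right n `<=` haar_supp n.
Proof.
move=> x; rewrite /haar_right /haar_supp/= !in_itv/= => /andP[? ?].
by have h0 := haar_step_gt0 n; apply/andP; split; lra.
Qed.

Lemma haar_supp01 n : haar_supp n `<=` `]0, 1[.
Proof.
move=> x; rewrite /haar_supp/= !in_itv/= => /andP[? ?].
have := haar_step_gt0 n; have := haar_step_le n.
by move=> ? ?; apply/andP; split; lra.
Qed.

Lemma measure_haar_left n : mu (haar_left n) = (haar_step n)%:E.
Proof.
rewrite /haar_left lebesgue_measure_itv/= lte_fin; have := haar_step_gt0 n.
by move=> h0; rewrite ifT; [rewrite -EFinD; congr EFin|]; lra.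
Qed.

Lemma measure_haar_right n : mu (haar_right n) = (haar_step n)%:E.
Proof.
rewrite /haar_right lebesgue_measure_itv/= lte_fin; have := haar_step_gt0 n.
by move=> h0; rewrite ifT; [rewrite -EFinD; congr EFin|]; lra.
Qed.

Lemma integrable_indic_itvoo (a b : R) (D : set R) : measurable D ->
  mu.-integrable D (EFin \o \1_(`]a, b[%classic : set R)).
Proof. by move=> mD; exact: (integrableS _ mD _ (integrable_indic_itv a b false true)). Qed.

Lemma Rintegral_indic (D E : set R) : measurable D -> measurable E ->
  \int[mu]_(x in D) \1_E x = fine (mu (E `&` D)).
Proof. by move=> mD mE; rewrite /Rintegral integral_indic. Qed.

Lemma integrable_haar n (D : set R) : measurable D ->
  mu.-integrable D (EFin \o haar n).
Proof.
move=> mD; rewrite (_ : EFin \o haar n = (fun x => ((haar_step n)^-1)%:E *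
   ((EFin \o \1_(haar_left n)) \- (EFin \o \1_(haar_right n))) x)%E).
  by apply: integrableZl => //; apply: integrableB => //; exact: integrable_indic_itvoo.
by apply/funext => x.
Qed.

Lemma L1_01_haar n : L1_01 (haar n).
Proof. exact: integrable_haar. Qed.

Lemma Rintegral_haar n (D : set R) : measurable D ->
  \int[mu]_(x in D) haar n x = (haar_step n)^-1 *
    (fine (mu (haar_left n `&` D)) - fine (mu (haar_right n `&` D))).
Proof.
move=> mD; rewrite RintegralZl//; last first.
  by rewrite (_ : _ \o _ = (EFin \o \1_(haar_left n)) \- (EFin \o \1_(haar_right n)))%E//;
    apply: integrableB => //; exact: integrable_indic_itvoo.
rewrite RintegralB//; [|exact: integrable_indic_itvoo..].
by rewrite !Rintegral_indic//; exact: measurable_itv.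
Qed.

(** Biorthogonality, the source of the identity [Q (T x) = x]: distinct indices have disjoint
    supports, and the factor in [haar] normalises the diagonal. *)
Lemma Rintegral_haar_left m n :
  \int[mu]_(x in haar_left m) haar n x = (n == m)%:R.
Proof.
rewrite Rintegral_haar; last exact: measurable_itv.
have [->|nm] := eqVneq n m.
  rewrite setIid measure_haar_left (_ : _ `&` _ = set0).
    by rewrite measure0 subr0/= mulVf// gt_eqF// haar_step_gt0.
  apply/seteqP; split=> // x [].
  by rewrite /haar_right /haar_left/= !in_itv/= => /andP[? ?] /andP[? ?]; exfalso; lra.
have disj E : E `<=` haar_supp n -> E `&` haar_left m = set0.
  move=> En; apply/seteqP; split=> // x [/En xn /haar_left_supp xm].
  by move/eqP: nm; apply; apply: haar_supp_inj xn xm.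
rewrite !disj ?measure0 ?subrr ?mulr0//.
- exact: haar_right_supp.
- exact: haar_left_supp.
Qed.

Lemma Rintegral_normr_haar n : \int[mu]_(x in `]0, 1[) `|haar n x| <= 2.
Proof.
(* A pointwise majorant by the triangle inequality; each half contributes [1] to its integral. *)
pose g x : R := (haar_step n)^-1 * (\1_(haar_left n) x + \1_(haar_right n) x).
have ig : mu.-integrable `]0, 1[
    (EFin \o (fun x => \1_(haar_left n) x + \1_(haar_right n) x) : R -> \bar R).
  rewrite (_ : _ \o _ = (EFin \o \1_(haar_left n)) \+ (EFin \o \1_(haar_right n)))%E//.
  by apply: integrableD => //; exact: integrable_indic_itvoo.
have -> : 2 = \int[mu]_(x in `]0, 1[) g x.
  rewrite RintegralZl// RintegralD//; [|exact: integrable_indic_itvoo..].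
  rewrite !Rintegral_indic//; [|exact: measurable_itv..].
  rewrite !setIidl.
  - rewrite measure_haar_left measure_haar_right/= mulrDr mulVf//.
    by rewrite gt_eqF// haar_step_gt0.
  - by move=> x /haar_right_supp /haar_supp01.
  - by move=> x /haar_left_supp /haar_supp01.
apply: le_Rintegral => //.
- by have /integrable_norm := L1_01_haar n.
- exact: (@integrableZl _ _ _ mu _ _ (haar_step n)^-1 _ ig).
- move=> x _; rewrite /haar /g normrM gtr0_norm ?invr_gt0 ?haar_step_gt0//.
  rewrite ler_pM2l ?invr_gt0 ?haar_step_gt0//.
  by apply: le_trans (ler_normB _ _) _; rewrite !ger0_norm// indicE ler0n.
Qed.

(* The two halves of [haar n] cancel on an interval that contains the support. *)
Lemma Rintegral_haar_itv n (a b : R) : ~ haar_supp n a -> ~ haar_supp n b ->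
  \int[mu]_(x in `]a, b[) haar n x = 0.
Proof.
move=> na nb; rewrite Rintegral_haar//.
have [sub|nsub] := pselect (haar_supp n `<=` `]a, b[).
  rewrite !setIidl; first by rewrite measure_haar_left measure_haar_right subrr mulr0.
    by move=> x /haar_right_supp /sub.
  by move=> x /haar_left_supp /sub.
(* If the interval met the support, its end points, being outside the support, would lie on either
   side of it and the whole support would be contained. *)
have disj E : E `<=` haar_supp n -> E `&` `]a, b[ = set0.
  move=> En; apply/seteqP; split=> // x [/En xn /=]; rewrite in_itv/= => /andP[ax xb].
  apply: nsub => y; move: xn na nb; rewrite /haar_supp/= !in_itv/=.
  move=> /andP[? ?] /negP; rewrite negb_and -!leNgt => na.
  move=> /negP; rewrite negb_and -!leNgt => nb /andP[? ?].
  by case/orP: na => ?; case/orP: nb => ?; apply/andP; split; lra.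
rewrite !disj ?measure0 ?subrr ?mulr0//.
- exact: haar_right_supp.
- exact: haar_left_supp.
Qed.

End DyadicHaar.

(** * Bounded linear maps and extension from a dense domain *)

Section BoundedLinear.
Context {R : realType}.

Lemma linear_le_continuous (U V : normedModType R) (f : {linear U -> V}) (C : R) :
  (forall x, `|f x| <= C * `|x|) -> continuous f.
Proof.
move=> fC; apply/linear_bounded_continuous/ex_bound; exists `|C|.
near=> x; apply: le_trans (fC x) _; apply: le_trans (ler_norm _) _.
rewrite normrM normr_id; apply: ler_piMr; first exact: normr_ge0.
near: x; have := nbhsx_ballx (0 : U) 1 ltr01; apply: filterS => x.
by rewrite -ball_normE/= sub0r normrN => /ltW.
Unshelve. all: by end_near. Qed.

Lemma dense_dist (V : normedModType R) (S : set V) (z : V) (eps : R) :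
  dense S -> 0 < eps -> exists2 x, S x & `|z - x| < eps.
Proof.
move=> dS eps0; have [|x [zx Sx]] := dS (ball z eps) _ (ball_open _ _).
  by exists z; exact: ballxx.
by exists x => //; move: zx; rewrite -ball_normE.
Qed.

Lemma cvg_dist_harmonic (V : completeNormedModType R) (y : nat -> V) (C : R) :
  (forall m n, `|y m - y n| <= C * (m.+1%:R^-1 + n.+1%:R^-1)) -> cvgn y.
Proof.
move=> yC; apply/cauchy_cvgP/cauchy_exP => eps eps0.
have C0 : 0 <= C.
  have := le_trans (normr_ge0 _) (yC 0%N 0%N).
  by rewrite invr1 pmulr_lge0.
(* The summand [1] keeps the denominator positive when [C = 0]. *)
have d0 : 0 < eps / (C * 2 + 1) by rewrite divr_gt0// ltr_wpDl// mulr_ge0.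
have dE : (C * 2 + 1) * (eps / (C * 2 + 1)) = eps.
  by rewrite mulrC divfK// gt_eqF// ltr_wpDl// mulr_ge0.
have [N _ HN] := near_infty_natSinv_lt (PosNum d0).
exists (y N); exists N => // n /= Nn.
rewrite -ball_normE/=; apply: le_lt_trans (yC _ _) _.
move: (HN _ Nn) (HN _ (leqnn N)) => {HN} /=.
move: (eps / _) dE d0 => d dE d0 nd Nd; rewrite -dE.
apply: (@le_lt_trans _ _ (C * (d + d))); last by lra.
by rewrite ler_wpM2l// lerD ?ltW.
Qed.

(* [G] is the graph of a densely defined operator of norm at most [C]. *)
Lemma linear_extension (U : normedModType R) (V : completeNormedModType R)
    (G : U -> V -> Prop) (C : R) :
  0 <= C ->
  (forall (k : R) x y x' y', G x y -> G x' y' -> G (k *: x + x') (k *: y + y')) ->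
  (forall x y, G x y -> `|y| <= C * `|x|) ->
  dense [set x | exists y, G x y] ->
  exists T : {linear U -> V},
    (forall x, `|T x| <= C * `|x|) /\ (forall x y, G x y -> T x = y).
Proof.
move=> C0 Glin GC Gdense.
(* The case [k = -1] of linearity; in particular [G] is single-valued. *)
have Gdist x y x' y' : G x y -> G x' y' -> `|y - y'| <= C * `|x - x'|.
  move=> Gxy Gxy'; have := GC _ _ (Glin (-1) _ _ _ _ Gxy' Gxy).
  by rewrite !scaleN1r ![- _ + _]addrC.
have near (z : U) (eps : R) : 0 < eps -> exists x y, G x y /\ `|z - x| < eps.
  by move=> /(dense_dist _ _ z _ Gdense)[x [y Gxy] zx]; exists x, y.
have [x0 [y0 [G0 _]]] := near 0 1 ltr01.
have {x0 y0 G0} G0 : G 0 0.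
  by have := Glin (-1) _ _ _ _ G0 G0; rewrite !scaleN1r !addNr.
(* An estimate against every graph point pins down the value at [z]: taken at [x = z] it gives
   [T z = y], and at the graph point [(0, 0)] it gives the norm bound. *)
have ext (z : U) : exists t, forall x y, G x y -> `|t - y| <= C * `|z - x|.
  have /choice[xy Hxy] n : exists p : U * V, G p.1 p.2 /\ `|z - p.1| < n.+1%:R^-1.
    have [|x [y [Gxy zx]]] := near z (n.+1%:R^-1); first by rewrite invr_gt0.
    by exists (x, y).
  have cy : cvgn (fun n => (xy n).2).
    apply: (cvg_dist_harmonic _ _ C) => m n.
    have [Gm xm] := Hxy m; have [Gn xn] := Hxy n.
    apply: le_trans (Gdist _ _ _ _ Gm Gn) _; rewrite ler_wpM2l//.
    rewrite -(subrK z (xy m).1) -addrA; apply: le_trans (ler_normD _ _) _.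
    by rewrite lerD ?ltW// distrC.
  exists (limn (fun n => (xy n).2)) => x y Gxy.
  have cd : `|(xy n).2 - y| @[n --> \oo] --> `|limn (fun n => (xy n).2) - y|.
    by apply: cvg_norm; apply: cvgB => //; exact: cvg_cst.
  rewrite -(cvg_lim _ cd)//; apply/ler_addgt0Pr => eps eps0.
  apply: limr_le; first by apply/cvg_ex; eexists; exact: cd.
  have eC : 0 < eps / (C + 1) by rewrite divr_gt0// ltr_wpDl.
  have [N _ HN] := near_infty_natSinv_lt (PosNum eC).
  exists N => // n /HN/= Hn.
  have [Gn xn] := Hxy n; apply: le_trans (Gdist _ _ _ _ Gn Gxy) _.
  apply: (@le_trans _ _ (C * (n.+1%:R^-1 + `|z - x|))).
    rewrite ler_wpM2l// -(subrK z (xy n).1) -addrA.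
    by apply: le_trans (ler_normD _ _) _; rewrite lerD2r distrC ltW.
  rewrite mulrDr addrC lerD2l; apply: (@le_trans _ _ ((C + 1) * (eps / (C + 1)))).
    by rewrite ler_pM ?invr_ge0// ?lerDl// ltW.
  by rewrite mulrC divfK// gt_eqF// ltr_wpDl.
have [T HT] := choice ext.
have TG x y : G x y -> T x = y.
  move=> /(HT x); rewrite subrr normr0 mulr0 normr_le0 subr_eq0.
  by move/eqP.
have Tlin : linear T.
  move=> k z z'; apply/eqP; rewrite -subr_eq0 -normr_le0.
  apply/ler_addgt0Pr => eps eps0; rewrite add0r.
  (* The domain error and the image error each cost at most [C * (|k| + 1) * d]. *)
  pose d := eps / (2 * (C + 1) * (`|k| + 1)).
  have C1 : 0 < C + 1 by rewrite ltr_wpDl.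
  have k1 : 0 < `|k| + 1 by rewrite ltr_wpDl.
  have d0 : 0 < d by rewrite divr_gt0// !mulr_gt0.
  have [x [y [Gxy zx]]] := near z d d0.
  have [x' [y' [Gxy' zx']]] := near z' d d0.
  have := HT (k *: z + z') _ _ (Glin k _ _ _ _ Gxy Gxy').
  have := HT z _ _ Gxy; have := HT z' _ _ Gxy' => H' H H0.
  have domain_near : `|k *: z + z' - (k *: x + x')| <= `|k| * d + d.
    have -> : k *: z + z' - (k *: x + x') = k *: (z - x) + (z' - x').
      by rewrite scalerBr addrACA -opprD.
    apply: le_trans (ler_normD _ _) _.
    by rewrite normrZ lerD// ?ler_wpM2l// ltW.
  have image_near : `|k *: (T z - y) + (T z' - y')| <= `|k| * (C * d) + C * d.
    apply: le_trans (ler_normD _ _) _; rewrite normrZ lerD//.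
      by rewrite ler_wpM2l//; apply: le_trans H _; rewrite ler_wpM2l// ltW.
    by apply: le_trans H' _; rewrite ler_wpM2l// ltW.
  have -> : T (k *: z + z') - (k *: T z + T z') =
      (T (k *: z + z') - (k *: y + y')) - (k *: (T z - y) + (T z' - y')).
    by rewrite scalerBr addrACA -opprD opprB addrA subrK.
  apply: le_trans (ler_normB _ _) _.
  apply: le_trans (lerD (le_trans H0 (ler_wpM2l C0 domain_near)) image_near) _.
  have -> : eps = 2 * (C + 1) * (`|k| + 1) * d.
    by rewrite /d mulrC divfK// gt_eqF// !mulr_gt0.
  have : 0 <= (`|k| + 1) * d by rewrite mulr_ge0 ?ltW.
  by move: (C0) => /= C0' kd; nra.
pose LT := HB.pack_for {linear U -> V} T (GRing.isLinear.Build _ _ _ _ T Tlin).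
exists LT; split=> // z.
by have := HT z _ _ G0; rewrite !subr0.
Qed.

End BoundedLinear.

(** * Estimates for the two operators in the [JF] norm *)

Section JFNorm.
Context {R : realType} {X : completeNormedModType R} {e : nat -> X}.
Local Notation mu := (@lebesgue_measure R).
Context (e_sym : one_symmetric e).

(** The point is that the set under [sup] is bounded above, here by the L^1 norm of [f] times the
    norm of [e 0]. *)
Lemma JF_norm_ge (f : R -> R) (m : nat) (a b : 'I_m -> R) : L1_01 f ->
  (forall j, [/\ 0 <= a j, a j < b j & b j <= 1]) ->
  trivIset [set: 'I_m] (fun j => `]a j, b j[%classic) ->
  `|\sum_(j < m) (\int[mu]_(x in `]a j, b j[) f x) *: e j| <= JF_norm e f.
Proof.
move=> fL ab tab; apply: ub_le_sup; last by exists m, a, b.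
exists ((\int[mu]_(x in `]0, 1[) `|f x|) * `|e 0|) => _ [n [c [d [cd tcd ->]]]].
apply: le_trans (ler_norm_sum _ _ _) _.
under eq_bigr do rewrite normrZ (symmetric_norm_basis e_sym).
rewrite -mulr_suml ler_wpM2r//; apply: sum_normr_Rintegral => // j x.
have [c0 _ d1] := cd j; rewrite /= !in_itv/= => /andP[cx xd].
by rewrite (le_lt_trans c0 cx) (lt_le_trans xd d1).
Qed.

Lemma JF_norm_le (f : R -> R) (C : R) :
  (forall m (a b : 'I_m -> R), (forall j, [/\ 0 <= a j, a j < b j & b j <= 1]) ->
    trivIset [set: 'I_m] (fun j => `]a j, b j[%classic) ->
    `|\sum_(j < m) (\int[mu]_(x in `]a j, b j[) f x) *: e j| <= C) ->
  JF_norm e f <= C.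
Proof.
move=> fC; apply: ge_sup; last by move=> _ [m [a [b [ab tab ->]]]]; exact: fC.
(* The empty family of intervals shows that the set under [sup] is nonempty. *)
exists `|\sum_(j < 0) (\int[mu]_(x in `](0 : R), 1[) f x) *: e j|.
by exists 0%N, (fun=> 0), (fun=> 1); split => // -[].
Qed.

Lemma L1_01_comb (k : R) (f g : R -> R) : L1_01 f -> L1_01 g ->
  L1_01 (fun x => k * f x + g x).
Proof.
move=> fL gL; rewrite /L1_01/= (_ : _ \o _ =
    (fun x => k%:E * (EFin \o f) x) \+ (EFin \o g))%E//.
by apply: integrableD => //; exact: integrableZl.
Qed.

Lemma Rintegral_comb (D : set R) (k : R) (f g : R -> R) :
  @measurable _ (measurableTypeR R) D -> D `<=` `]0, 1[ -> L1_01 f -> L1_01 g ->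
  \int[mu]_(x in D) (k * f x + g x) =
    k * (\int[mu]_(x in D) f x) + \int[mu]_(x in D) g x.
Proof.
move=> mD D01 fL gL.
have fD : mu.-integrable D (EFin \o f) by apply: (integrableS _ mD D01 fL).
have gD : mu.-integrable D (EFin \o g) by apply: (integrableS _ mD D01 gL).
rewrite RintegralD//; last exact: (@integrableZl _ _ _ mu _ mD k _ fD).
by rewrite RintegralZl.
Qed.

Lemma L1_01_0 : L1_01 (fun=> 0 : R).
Proof. exact: integrable0. Qed.

Definition haar_sum (N : nat) (a : nat -> R) (x : R) : R :=
  \sum_(n < N) a n * haar n x.

Lemma haar_sum0 a : haar_sum 0 a = fun=> 0.
Proof. by apply/funext => x; rewrite /haar_sum big_ord0. Qed.

Lemma haar_sumS N a :
  haar_sum N.+1 a = fun x => a N * haar N x + haar_sum N a x.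
Proof. by apply/funext => x; rewrite /haar_sum big_ord_recr/= addrC. Qed.

Lemma L1_01_haar_sum N a : L1_01 (haar_sum N a).
Proof.
elim: N => [|N IH]; first by rewrite haar_sum0; exact: L1_01_0.
by rewrite haar_sumS; apply: L1_01_comb => //; exact: L1_01_haar.
Qed.

Lemma Rintegral_haar_sum N a (D : set R) :
  @measurable _ (measurableTypeR R) D -> D `<=` `]0, 1[ ->
  \int[mu]_(x in D) haar_sum N a x = \sum_(n < N) (\int[mu]_(x in D) haar n x) * a n.
Proof.
move=> mD D01; elim: N => [|N IH].
  by rewrite haar_sum0 big_ord0 Rintegral_cst// mul0r.
rewrite haar_sumS Rintegral_comb//; last 2 first.
- exact: L1_01_haar.
- exact: L1_01_haar_sum.
by rewrite IH big_ord_recr/= addrC mulrC.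
Qed.

(* An interval integrates to zero against [haar n] unless one of its end points
   lies in the support. Hence the matrix of these integrals is the sum of two
   matrices with at most one entry in each row, and its column sums are at most
   the L^1 norm [2] of [haar n]. *)
Lemma JF_norm_haar_sum N a :
  JF_norm e (haar_sum N a) <= 4 * `|\sum_(n < N) a n *: e n|.
Proof.
apply: JF_norm_le => m a0 b0 ab tab; set K := `|\sum_(n < N) _|.
have I01 j : `]a0 j, b0 j[ `<=` (`]0, 1[ : set R).
  have [c0 _ d1] := ab j => x; rewrite /= !in_itv/= => /andP[cx xd].
  by rewrite (le_lt_trans c0 cx) (lt_le_trans xd d1).
pose D j n := \int[mu]_(x in `]a0 j, b0 j[) haar n x.
have Dcol n : \sum_(j < m) `|D j n| <= 2.
  apply: le_trans (Rintegral_normr_haar n); apply: sum_normr_Rintegral => //.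
  exact: L1_01_haar.
have part (P : 'I_m -> nat -> bool) : (forall j n k, P j n -> P j k -> n = k) ->
    `|\sum_(j < m) (\sum_(n < N) (if P j n then D j n else 0) * a n) *: e j| <= 2 * K.
  move=> Pinj.
  (* Halving brings the column sums below [1]; rows beyond [m] are filled with [0] because the
     matrix lemma indexes rows by naturals. *)
  pose E (j n : nat) : R :=
    if insub j is Some i then (if P i n then D i n else 0) / 2 else 0.
  have EE (j : 'I_m) n : E j n = (if P j n then D j n else 0) / 2.
    by rewrite /E valK.
  have -> : \sum_(j < m) (\sum_(n < N) (if P j n then D j n else 0) * a n) *: e j =
      2 *: \sum_(j < m) (\sum_(n < N) E j n * a n) *: e j.
    rewrite scaler_sumr; apply: eq_bigr => j _; rewrite scalerA; congr (_ *: _).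
    rewrite mulr_sumr; apply: eq_bigr => n _; rewrite EE mulrA; congr (_ * _).
    by rewrite mulrC divfK.
  rewrite normrZ ger0_norm// ler_wpM2l//.
  apply: (symmetric_disjoint_columns e_sym) => [j n k nk|n].
    rewrite /E; case: insubP => [i _ _|_]; last by rewrite mul0r.
    case: ifPn => Pn; last by rewrite !mul0r.
    case: ifPn => Pk; last by rewrite mul0r mulr0.
    by rewrite (Pinj i n k) ?eqxx in nk.
  apply: (@le_trans _ _ (\sum_(j < m) `|D j n| / 2)); last first.
    by rewrite -mulr_suml ler_pdivrMr// mul1r.
  apply: ler_sum => j _; rewrite EE normrM [`|2^-1|]gtr0_norm ?invr_gt0//.
  by rewrite ler_wpM2r ?invr_ge0//; case: ifP => // _; rewrite normr0.
(* [P2] excludes the indices of [P1], so that an interval with both end points in one support is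
   counted once. *)
pose P1 j n := a0 j \in haar_supp n.
pose P2 j n := (a0 j \notin haar_supp n) && (b0 j \in haar_supp n).
have -> : \sum_(j < m) (\int[mu]_(x in `]a0 j, b0 j[) haar_sum N a x) *: e j =
    \sum_(j < m) (\sum_(n < N) (if P1 j n then D j n else 0) * a n) *: e j +
    \sum_(j < m) (\sum_(n < N) (if P2 j n then D j n else 0) * a n) *: e j.
  rewrite -big_split/=; apply: eq_bigr => j _; rewrite -scalerDl.
  rewrite Rintegral_haar_sum// -big_split/=; congr (_ *: _).
  apply: eq_bigr => n _; rewrite -mulrDl; congr (_ * _); rewrite /P1 /P2.
  have [an|an] := boolP (a0 j \in haar_supp n); first by rewrite addr0.
  have [bn|bn] := boolP (b0 j \in haar_supp n); first by rewrite add0r.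
  rewrite addr0; apply: Rintegral_haar_itv; apply/negP.
  - by apply: contra an; rewrite inE.
  - by apply: contra bn; rewrite inE.
have -> : 4 * K = 2 * K + 2 * K by lra.
apply: le_trans (ler_normD _ _) _; apply: lerD; apply: part => j n k; rewrite /P1 /P2.
- by rewrite !inE; exact: haar_supp_inj.
- by move=> /andP[_ +] /andP[_]; rewrite !inE; exact: haar_supp_inj.
Qed.

(** These are partial sums; the vector [q f] is their limit. *)
Definition haar_coef (f : R -> R) : nat -> X :=
  series (fun n => (\int[mu]_(x in haar_left n) f x) *: e n).

Lemma haar_left01 n : haar_left n `<=` (`]0, 1[ : set R).
Proof. by move=> x /haar_left_supp /haar_supp01. Qed.

Lemma haar_left_trivIset (D : set nat) : trivIset D (@haar_left R).
Proof.
by move=> i j _ _ [x [/haar_left_supp xi /haar_left_supp xj]];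
  exact: haar_supp_inj xi xj.
Qed.

Lemma haar_coefE f N :
  haar_coef f N = \sum_(n < N) (\int[mu]_(x in haar_left n) f x) *: e n.
Proof. by rewrite /haar_coef/series/= big_mkord. Qed.

(** The convergence is absolute: all [e n] have the same norm, and the integrals over the disjoint
    left halves are summable. *)
Lemma is_cvg_haar_coef f : L1_01 f -> cvgn (haar_coef f).
Proof.
move=> fL; apply: normed_cvg; apply: nondecreasing_is_cvgn.
  by apply: nondecreasing_series => n _ _; exact: normr_ge0.
exists ((\int[mu]_(x in `]0, 1[) `|f x|) * `|e 0|) => _ [N _ <-].
rewrite /= seriesEord/=.
under eq_bigr do rewrite normrZ (symmetric_norm_basis e_sym).
rewrite -mulr_suml ler_wpM2r//; apply: sum_normr_Rintegral => // [j|j|i j _ _ ij].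
- exact: measurable_itv.
- exact: haar_left01.
- by apply/val_inj; exact: (haar_left_trivIset setT).
Qed.

(** Finitely many left halves form an admissible family, so each partial sum competes in the
    supremum. *)
Lemma haar_coef_le f : L1_01 f -> `|limn (haar_coef f)| <= JF_norm e f.
Proof.
move=> fL; have cf := is_cvg_haar_coef _ fL; rewrite -lim_norm//.
apply: limr_le; first exact: is_cvg_norm.
near=> N; rewrite haar_coefE.
apply: (JF_norm_ge _ _ (fun j : 'I_N => 2 * haar_step j) (fun j => 3 * haar_step j)) => //.
- move=> j; have := @haar_step_gt0 R j; have := @haar_step_le R j.
  by move=> ? ?; split; lra.
- by move=> i j _ _ ij; apply/val_inj; exact: (haar_left_trivIset setT).
Unshelve. all: by end_near. Qed.

Lemma haar_coef_comb (k : R) f g : L1_01 f -> L1_01 g ->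
  limn (haar_coef (fun x => k * f x + g x)) =
  k *: limn (haar_coef f) + limn (haar_coef g).
Proof.
move=> fL gL; apply/cvg_lim => //.
rewrite (_ : haar_coef _ = fun N => k *: haar_coef f N + haar_coef g N).
  apply: cvgD; last exact: is_cvg_haar_coef.
  by apply: cvgZl_tmp; exact: is_cvg_haar_coef.
apply/funext => N; rewrite !haar_coefE scaler_sumr -big_split/=.
apply: eq_bigr => n _; rewrite Rintegral_comb// ?scalerDl ?scalerA//.
- exact: measurable_itv.
- exact: haar_left01.
Qed.

Lemma lim_haar_coef_haar n : limn (haar_coef (haar n)) = e n.
Proof.
apply/cvg_lim => //; apply: cvg_near_cst.
(* By biorthogonality the partial sums are constant once index [n] is included. *)
exists n.+1 => // N /= nN; rewrite haar_coefE (bigD1 (Ordinal nN))//=.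
rewrite Rintegral_haar_left eqxx scale1r big1 ?addr0// => k kn.
rewrite Rintegral_haar_left; have /negbTE -> : n != k.
  by apply: contra kn => /eqP nk; apply/eqP/val_inj.
by rewrite scale0r.
Qed.

End JFNorm.

(** * Construction of [T] and [Q] and of the projection *)

Lemma sum_truncated (R : realType) (V : lmodType R) (v : nat -> V) (a : nat -> R)
    (N M : nat) : (N <= M)%N ->
  \sum_(n < M) (if (n < N)%N then a n else 0) *: v n = \sum_(n < N) a n *: v n.
Proof.
move=> NM; rewrite (big_ord_widen _ (fun n => a n *: v n) NM) [RHS]big_mkcond/=.
by apply: eq_bigr => n _; case: ifP => // _; rewrite scale0r.
Qed.

Lemma iota_haar_sum (R : realType) (X : completeNormedModType R) (e : nat -> X)
    (J : completeNormedModType R) (iota : (R -> R) -> J) (N : nat) (a : nat -> R) :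
  is_JF e iota -> iota (haar_sum N a) = \sum_(n < N) a n *: iota (haar n).
Proof.
move=> [iotaD _ _]; elim: N => [|N IH].
  (* Additivity at zero gives [iota 0 = iota 0 + iota 0], hence [iota 0 = 0]. *)
  rewrite haar_sum0 big_ord0; have := iotaD 1 _ _ L1_01_0 L1_01_0.
  rewrite (_ : (fun=> _) = fun=> 0); last by apply/funext => x; rewrite mulr0 addr0.
  by rewrite scale1r -[LHS]addr0 => /addrI.
rewrite haar_sumS iotaD; last 2 first.
- exact: L1_01_haar.
- exact: L1_01_haar_sum.
by rewrite IH big_ord_recr/= addrC.
Qed.

Theorem theorem2p6 (R : realType) (X : completeNormedModType R) (e : nat -> X)
    (reflX : reflexive_space X) (basis_e : one_symmetric_basis e)
    (JF : completeNormedModType R) (iota : (R -> R) -> JF)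
    (JF_completion : is_JF e iota) :
  exists Y : set JF, complemented Y /\ isomorphic_to_subspace X Y.
Proof.
have [e_basis e_sym] := basis_e.
have [iotaD iota_norm iota_dense] := JF_completion.
(* The graph of [T] on finite combinations. Requiring the identities for all large [N] lets two
   elements be expanded to a common length. *)
pose spanE (x : X) (y : JF) := exists a : nat -> R, \forall N \near \oo,
  x = \sum_(n < N) a n *: e n /\ y = \sum_(n < N) a n *: iota (haar n).
have spanE_dense : dense [set x | exists y, spanE x y].
  move=> O [x Ox] oO; have [a [ax _]] := e_basis x.
  have [N _ HN] := ax O (open_nbhs_nbhs (conj oO Ox)).
  exists (\sum_(n < N) a n *: e n); split.
    by have := HN N (leqnn N); rewrite /= seriesEord.
  exists (\sum_(n < N) a n *: iota (haar n)).
  exists (fun n => if (n < N)%N then a n else 0), N => // M /= NM.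
  split; apply/esym; first exact: sum_truncated.
  exact: (sum_truncated _ _ (fun n => iota (haar n))).
have spanE_comb (k : R) x y x' y' :
    spanE x y -> spanE x' y' -> spanE (k *: x + x') (k *: y + y').
  move=> [a [N _ Na]] [b [M _ Mb]]; exists (fun n => k * a n + b n).
  exists (maxn N M) => // L /=; rewrite geq_max => /andP[/Na[-> ->] /Mb[-> ->]].
  by rewrite !scaler_sumr -!big_split/=; split; apply: eq_bigr => n _;
    rewrite scalerDl scalerA.
have spanE_le x y : spanE x y -> `|y| <= 4 * `|x|.
  move=> [a [N _ /(_ _ (leqnn N))[-> ->]]].
  rewrite -(iota_haar_sum _ _ _ _ _ _ _ JF_completion) iota_norm.
    exact: JF_norm_haar_sum.
  exact: L1_01_haar_sum.
(* A relation rather than a function, since [iota] may identify different functions; linearity and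
   [coef_le] make it single-valued. *)
pose coef (z : JF) (x : X) :=
  exists f, [/\ L1_01 f, z = iota f & x = limn (haar_coef (e := e) f)].
have coef_comb (k : R) z x z' x' :
    coef z x -> coef z' x' -> coef (k *: z + z') (k *: x + x').
  move=> [f [fL -> ->]] [g [gL -> ->]]; exists (fun t => k * f t + g t).
  by split; [exact: L1_01_comb|rewrite iotaD|rewrite haar_coef_comb].
have coef_le z x : coef z x -> `|x| <= 1 * `|z|.
  by move=> [f [fL -> ->]]; rewrite mul1r iota_norm//; exact: haar_coef_le.
have coef_dense : dense [set z | exists x, coef z x].
  move=> O O0 oO; have [z [Oz [f fL fz]]] := iota_dense O O0 oO.
  by exists z; split=> //; exists (limn (haar_coef (e := e) f)), f.
have [T [T_le TE]] := linear_extension _ _ _ _ (ler0n R 4) spanE_comb spanE_le spanE_dense.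
have [Q [Q_le QE]] := linear_extension _ _ _ _ ler01 coef_comb coef_le coef_dense.
have Q_haar n : Q (iota (haar n)) = e n.
  apply: QE; exists (haar n); rewrite lim_haar_coef_haar; split=> //.
  exact: L1_01_haar.
have T_cont := linear_le_continuous _ _ _ _ T_le.
have Q_cont := linear_le_continuous _ _ _ _ Q_le.
have TK : cancel T Q.
  move=> x; apply/eqP; rewrite -subr_eq0 -normr_le0.
  apply/ler_addgt0Pr => eps eps0; rewrite add0r.
  (* The norm of [Q T - id] is at most [1 * 4 + 1 = 5], and this map vanishes on the dense span. *)
  have d0 : 0 < eps / 5 by rewrite divr_gt0.
  have [x' [y' xy'] xx'] := dense_dist _ _ x _ spanE_dense d0.
  have QTx' : Q (T x') = x'.
    rewrite (TE _ _ xy'); have [a [N _ /(_ _ (leqnn N))[-> ->]]] := xy'.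
    by rewrite linear_sum; apply: eq_bigr => n _; rewrite linearZ/= Q_haar.
  have -> : Q (T x) - x = Q (T (x - x')) - (x - x').
    by rewrite [T (_ - _)]linearB [Q (_ - _)]linearB/= QTx' opprB addrA subrK.
  apply: le_trans (ler_normB _ _) _.
  have := T_le (x - x'); have := Q_le (T (x - x')); lra.
exists (range T); split.
  exists (T \o Q : {linear JF -> JF}); split=> [|z|].
  - by move=> z; apply: continuous_comp; [exact: Q_cont|exact: T_cont].
  - by rewrite /= TK.
  - apply/seteqP; split=> [_ [z _ <-]|_ [x _ <-]]; first by exists (Q z).
    by exists (T x) => //=; rewrite TK.
(* The inverse of [T] on its range is the restriction of [Q], which is continuous on all of [JF]. *)
exists T, Q; split=> //.
exact: continuous_subspaceT.
Qed.
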